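(* Let $d\ge1$, $M=2^d$, $p\in(0,1]$, $r=1/p-1/2$, and consider estimating an unknown density $f\in\mathcal F^{+,1}_d(p)$ from $n$ i.i.d. samples $X_1,\dots,X_n$ drawn from $f$; the infimum below is over all estimators $\widehat f_n$ (functions of $X_1,\dots,X_n$ with values in real functions on $\{0,1\}^d$). (1) For every $\epsilon\in(0,1)$ there is a constant $C=C(p,\epsilon)>0$ such that whenever $\log M\le n\le M^{2(1-\epsilon)/p}$, $$\inf_{\widehat f_n}\sup_{f\in\mathcal F^{+,1}_d(p)}\mathbb E_f\|\widehat f_n-f\|^2_{L^2(\mu_d)}\ge\frac{C}{M}\left(\frac{\log M}{n}\right)^{2r/(2r+1)}.$$ (2) There is an absolute constant $C>0$ such that whenever $n\ge M^{2/p}$ and $M\ge4$, $$\inf_{\widehat f_n}\sup_{f\in\mathcal F^{+,1}_d(p)}\mathbb E_f\|\widehat f_n-f\|^2_{L^2(\mu_d)}\ge\frac{C}{n}.$$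
   Context: $\mu_d$ is counting measure on $\{0,1\}^d$, $\|g\|^2_{L^2(\mu_d)}=\sum_x g(x)^2$, $\log$ is the natural logarithm. Walsh functions: $\varphi_s(x)=2^{-d/2}(-1)^{\sum_j s^{(j)}x^{(j)}}$ for $s,x\in\{0,1\}^d$, and $\theta_s(g)=\sum_x g(x)\varphi_s(x)$. $\mathcal F_d(p)$ is the set of $g:\{0,1\}^d\to\mathbb R$ such that, with $|\theta_{(1)}|\ge\dots\ge|\theta_{(M)}|$ the coefficients of $g$ sorted by decreasing magnitude, $|\theta_{(m)}|\le M^{-1/2}m^{-1/p}$ for $1\le m\le M$; $\mathcal F^{+,1}_d(p)$ is the set of $g\in\mathcal F_d(p)$ with $g\ge0$ and $\sum_x g(x)=1$. *)

(* Defs.v *)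
From HB Require Import structures.
From mathcomp Require Import all_boot all_order all_algebra.
From mathcomp Require Import reals exp.
Unset Implicit Arguments.
Import Order.TTheory GRing.Theory Num.Theory.
Local Open Scope ring_scope.

Definition cube (d : nat) : finType := {ffun 'I_d -> bool}.

Definition Mr (R : realType) (d : nat) : R := (2 ^ d)%:R.

Definition walsh (R : realType) (d : nat) (s x : cube d) : R :=
  (Num.sqrt (Mr R d))^-1 * (-1) ^+ (\sum_(j < d) (s j && x j : nat))%N.

Definition theta (R : realType) (d : nat) (g : cube d -> R) (s : cube d) : R :=
  \sum_(x : cube d) g x * walsh R d s x.

(* |theta_(1)| >= ... >= |theta_(M)| : the coefficient magnitudes sorted
   decreasingly (list index i corresponds to m = i+1) *)
Definition sorted_coefs (R : realType) (d : nat) (g : cube d -> R) : seq R :=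
  sort (fun a b : R => b <= a) [seq `|theta R d g s| | s <- enum (cube d)].

Definition Fclass (R : realType) (d : nat) (p : R) (g : cube d -> R) : Prop :=
  forall i : nat, (i < 2 ^ d)%N ->
    nth 0 (sorted_coefs R d g) i <=
      (Num.sqrt (Mr R d))^-1 * powR (i.+1)%:R (- p^-1).

Definition Fclass_plus1 (R : realType) (d : nat) (p : R) (g : cube d -> R) : Prop :=
  Fclass R d p g /\ (forall x, 0 <= g x) /\ \sum_(x : cube d) g x = 1.

Definition sample (d n : nat) : finType := {ffun 'I_n -> cube d}.
Definition estimator (R : realType) (d n : nat) : Type := sample d n -> (cube d -> R).

Definition risk (R : realType) (d n : nat) (fhat : estimator R d n) (f : cube d -> R) : R :=
  \sum_(X : sample d n) (\prod_(i < n) f (X i)) *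
     \sum_(x : cube d) (fhat X x - f x) ^+ 2.

Definition sup_risk_ge (R : realType) (d n : nat) (p : R) (fhat : estimator R d n) (b : R) : Prop :=
  forall b', b' < b -> exists f : cube d -> R, Fclass_plus1 R d p f /\ b' < risk R d n fhat f.

Definition minimax_ge (R : realType) (d n : nat) (p : R) (b : R) : Prop :=
  forall fhat : estimator R d n, sup_risk_ge R d n p fhat b.

(* Main.v *)
(* Split part of the nonzero characters into k blocks of B, and let a random
   density be 1/M plus, for each block, one uniformly chosen character of the
   block with coefficient +a or -a. Given the choices made in the other blocks,
   a block is a problem with 2B hypotheses, each at chi-square distance at most
   2 M a^2 from the density with that block removed; as long as
   exp(2 n M a^2) <= 3B/2, the posterior cannot single out one of them and the
   block contributes at least a^2/8 to the Bayes risk. Summing over the blocks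
   gives k a^2 / 8. Part (1) takes k about (n / log M)^(p/2) and B about M/k;
   part (2) takes every nonzero character as a block of its own. *)

Require Import Defs.
From HB Require Import structures.
From mathcomp Require Import all_boot all_order all_algebra.
From mathcomp Require Import reals sequences exp.
From mathcomp Require Import ring lra zify.
Import Order.TTheory GRing.Theory Num.Theory.
Local Open Scope ring_scope.

(** * Walsh basis: orthonormality, Parseval, sorted coefficients *)

Lemma Mr_gt0 (R : realType) d : 0 < Mr R d.
Proof. by rewrite /Mr ltr0n expn_gt0. Qed.

Lemma sqrtMr_gt0 (R : realType) d : 0 < Num.sqrt (Mr R d).
Proof. by rewrite sqrtr_gt0 Mr_gt0. Qed.

Lemma sqr_sqrtMr (R : realType) d : Num.sqrt (Mr R d) ^+ 2 = Mr R d.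
Proof. by rewrite sqr_sqrtr // ltW // Mr_gt0. Qed.

Lemma walshC (R : realType) d (s x : cube d) : walsh R d s x = walsh R d x s.
Proof.
by rewrite /walsh; congr (_ * (-1) ^+ _); apply: eq_bigr => j _; rewrite andbC.
Qed.

Lemma norm_walsh (R : realType) d (s x : cube d) :
  `|walsh R d s x| = (Num.sqrt (Mr R d))^-1.
Proof.
rewrite /walsh normrM normrX normrN1 expr1n mulr1 ger0_norm //.
by rewrite invr_ge0 sqrtr_ge0.
Qed.

(** The product of two characters factors over coordinates, so the sum over the cube is a product of
    one-bit sums; a coordinate where [s] and [t] differ contributes a zero factor. *)
Lemma walsh_orthonormal (R : realType) d (s t : cube d) :
  \sum_x walsh R d s x * walsh R d t x = (s == t)%:R.
Proof.
pose F (j : 'I_d) (b : bool) : R :=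
  (-1) ^+ (s j && b : nat) * (-1) ^+ (t j && b : nat).
have walshE x : walsh R d s x * walsh R d t x = (Mr R d)^-1 * \prod_j F j (x j).
  rewrite /walsh mulrACA -invfM -expr2 sqr_sqrtMr big_split /=.
  by rewrite !prodrXr.
under eq_bigr do rewrite walshE.
rewrite -mulr_sumr -(bigA_distr_bigA F).
have FE j : \sum_b F j b = 2 * (s j == t j)%:R.
  by rewrite big_bool /F !andbT !andbF; case: (s j); case: (t j) => /=; ring.
under eq_bigr do rewrite FE.
rewrite big_split /= prodr_const card_ord /Mr natrX mulrA mulVf ?mul1r; last first.
  by rewrite expf_neq0 // pnatr_eq0.
case: eqVneq => [->|neq_st]; first by rewrite big1 // => j _; rewrite eqxx.
have [j /negPf neq_j] : exists j, s j != t j.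
  apply/existsP; apply: contra_neqT neq_st; rewrite negb_exists => /forallP eq_st.
  by apply/ffunP => j; apply/eqP; rewrite -[_ == _]negbK.
by rewrite (bigD1 j) //= neq_j mul0r.
Qed.

(** By the symmetry of [walsh], orthonormality also holds when summing over the frequency; it
    expands the Kronecker delta of two points. *)
Lemma parseval (R : realType) d (g : cube d -> R) :
  \sum_x g x ^+ 2 = \sum_s theta R d g s ^+ 2.
Proof.
transitivity (\sum_x \sum_y g x * g y * (x == y)%:R).
  apply: eq_bigr => x _; rewrite (bigD1 x) //= eqxx mulr1 expr2.
  rewrite big1 ?addr0 // => y; rewrite eq_sym => /negPf ->.
  by rewrite mulr0.
under eq_bigr do under eq_bigr do rewrite -walsh_orthonormal mulr_sumr.
under eq_bigr do rewrite exchange_big.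
rewrite exchange_big; apply: eq_bigr => s _ /=.
rewrite expr2 mulr_suml; apply: eq_bigr => x _.
rewrite mulr_sumr; apply: eq_bigr => y _.
by rewrite (walshC _ _ x s) (walshC _ _ y s) mulrACA.
Qed.

Lemma thetaB (R : realType) d (f g : cube d -> R) s :
  theta R d (fun x => f x - g x) s = theta R d f s - theta R d g s.
Proof. by rewrite /theta -sumrB; apply: eq_bigr => x _; rewrite mulrBl. Qed.

Definition zcube d : cube d := [ffun => false].

Lemma walsh0 (R : realType) d (x : cube d) :
  walsh R d (zcube d) x = (Num.sqrt (Mr R d))^-1.
Proof. by rewrite /walsh big1 ?mulr1 // => j _; rewrite ffunE. Qed.

Lemma sum_walsh (R : realType) d (s : cube d) :
  s != zcube d -> \sum_x walsh R d s x = 0.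
Proof.
move=> /negPf s_neq0; have := walsh_orthonormal R d s (zcube d).
rewrite s_neq0; under eq_bigr do rewrite walsh0.
rewrite -mulr_suml => /eqP; rewrite mulf_eq0 invr_eq0.
by rewrite (gt_eqF (sqrtMr_gt0 _ _)) orbF => /eqP.
Qed.

Lemma walsh_sqr_sum (R : realType) d (s : cube d) :
  \sum_x walsh R d s x ^+ 2 = 1.
Proof. by under eq_bigr do rewrite expr2; rewrite walsh_orthonormal eqxx. Qed.

Lemma card_cube d : #|cube d| = (2 ^ d)%N.
Proof. by rewrite card_ffun card_bool card_ord. Qed.

(** In a decreasing list, an entry above [c] at index [i] puts all [i+1] entries up to it above [c].
    Past the end the default 0 is covered by [0 <= c]. *)
Lemma nth_sorted_coefs_le (R : realType) d (g : cube d -> R) (c : R) i : 0 <= c ->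
  (#|[set s | (c < `|theta R d g s|)%R]| <= i)%N ->
  nth 0 (sorted_coefs R d g) i <= c.
Proof.
move=> c_ge0 card_le; set l := sorted_coefs R d g.
have geT : total (fun a b : R => b <= a) by move=> a b; exact: le_total.
have ge_trans : transitive (fun a b : R => b <= a).
  by move=> a b e /= ab /le_trans; apply.
have srt : sorted (fun a b : R => b <= a) l by exact: sort_sorted.
have cnt : count (fun y => c < y) l = #|[set s | (c < `|theta R d g s|)%R]|.
  rewrite /l /sorted_coefs count_sort count_map cardE -size_filter.
  rewrite /enum_mem -filter_predI !size_filter /=.
  by apply: eq_count => s; rewrite /= !inE andbT.
rewrite leNgt; apply/negP => lt_c.
have lt_i : (i < size l)%N.
  by rewrite ltnNge; apply/negP => /(nth_default 0) nth0; move: lt_c; rewrite nth0 ltNge c_ge0.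
have : (i < count (fun y => (c < y)%R) l)%N.
  rewrite -(cat_take_drop i.+1 l) count_cat.
  apply: leq_trans (leq_addr _ _).
  have -> : count (fun y => c < y) (take i.+1 l) = size (take i.+1 l).
    apply/eqP; rewrite -all_count; apply/(all_nthP 0) => j.
    rewrite size_takel // => lt_j; rewrite nth_take //.
    apply: lt_le_trans lt_c _.
    apply: (sorted_leq_nth ge_trans _ _ srt) => //.
    - by rewrite inE (leq_ltn_trans _ lt_i) // -ltnS.
  by rewrite size_takel.
by rewrite cnt ltnNge card_le.
Qed.

(** * Bayes risk of a single block *)

(* Here [w v] is the likelihood of hypothesis [v] at a fixed sample. The best [t]
   still leaves [a^2 (W - u / W)] with [W = sum w] and [u = sum w^2]; replacing
   [u / W <= sqrt u] by its AM-GM bound with an arbitrary [Q] makes the estimate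
   linear in [u], so that summing over samples produces a chi-square moment. *)
Lemma signed_spike_loss (R : realType) B (w : 'I_B * bool -> R) (t : 'I_B -> R)
    (a Q : R) :
  (forall v, 0 <= w v) -> 0 < \sum_v w v -> 0 < Q ->
  a ^+ 2 * (\sum_v w v - ((\sum_v w v ^+ 2) / Q + Q) / 2) <=
  \sum_v w v * \sum_b (t b - a * (-1) ^+ v.2 * (b == v.1)%:R) ^+ 2.
Proof.
move=> w_ge0 W_gt0 Q_gt0.
set W := \sum_v w v in W_gt0 *; set u := \sum_v w v ^+ 2.
(* The loss depends on the signs only through this difference; it is minimal at [t b = a * D b / W],
   which is the square completed below. *)
pose D b := w (b, false) - w (b, true).
have sum_pair (F : 'I_B * bool -> R) :
    \sum_v F v = \sum_b (F (b, true) + F (b, false)).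
  transitivity (\sum_b \sum_s F (b, s)).
    by rewrite pair_bigA; apply: eq_bigr => -[].
  by apply: eq_bigr => b _; rewrite big_bool.
have lossE (v : 'I_B * bool) : \sum_b (t b - a * (-1) ^+ v.2 * (b == v.1)%:R) ^+ 2 =
    \sum_b t b ^+ 2 - 2 * a * (-1) ^+ v.2 * t v.1 + a ^+ 2.
  rewrite (bigD1 v.1) //= [in RHS](bigD1 v.1) //= eqxx.
  rewrite (eq_bigr (fun b => t b ^+ 2)); last first.
    by move=> b /negPf ->; rewrite mulr0 subr0.
  by case: v.2 => /=; rewrite ?expr0 ?expr1; ring.
have -> : \sum_v w v * \sum_b (t b - a * (-1) ^+ v.2 * (b == v.1)%:R) ^+ 2 =
    \sum_b (W * t b ^+ 2 - 2 * a * t b * D b) + a ^+ 2 * W.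
  under eq_bigr do rewrite lossE mulrDr mulrBr.
  rewrite big_split sumrB /= -mulr_suml -/W sumrB -mulr_sumr.
  rewrite -mulr_suml -/W [W * a ^+ 2]mulrC; congr (_ - _ + _).
  rewrite sum_pair; apply: eq_bigr => b _ /=.
  by rewrite /D expr0 expr1; ring.
have D_le : \sum_b D b ^+ 2 <= u.
  rewrite /u sum_pair; apply: ler_sum => b _; rewrite /D.
  by have := w_ge0 (b, true); have := w_ge0 (b, false); nra.
have u_le : u <= W ^+ 2.
  rewrite [W ^+ 2]expr2 {1}/W mulr_suml; apply: ler_sum => v _.
  rewrite expr2 ler_wpM2l // /W (bigD1 v) //= lerDl sumr_ge0 //.
have uW_le : u / W <= (u / Q + Q) / 2.
  have -> : u / W = (u / Q) * (Q / W) by field; rewrite !gt_eqF.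
  rewrite -subr_ge0.
  have -> : (u / Q + Q) / 2 - u / Q * (Q / W) =
     ((Q - u / W) ^+ 2 + (u * (W ^+ 2 - u)) / W ^+ 2) / (2 * Q).
    by field; rewrite !gt_eqF.
  have u_ge0 : 0 <= u by apply: sumr_ge0 => v _; rewrite sqr_ge0.
  rewrite divr_ge0 ?addr_ge0 ?sqr_ge0 ?divr_ge0 ?mulr_ge0 ?sqr_ge0 ?subr_ge0 ?(ltW Q_gt0) ?(ltW W_gt0) //.
have quad_ge : - (a ^+ 2 * (u / W)) <= \sum_b (W * t b ^+ 2 - 2 * a * t b * D b).
  apply: (@le_trans _ _ (\sum_b - (a ^+ 2 * D b ^+ 2 / W))).
    rewrite sumrN lerN2 -mulr_suml -mulr_sumr -mulrA ler_wpM2l ?sqr_ge0 //.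
    by rewrite ler_pM2r ?invr_gt0.
  apply: ler_sum => b _; rewrite -subr_ge0.
  have -> : W * t b ^+ 2 - 2 * a * t b * D b - - (a ^+ 2 * D b ^+ 2 / W) =
            (W * t b - a * D b) ^+ 2 / W by field; rewrite gt_eqF.
  by rewrite divr_ge0 ?sqr_ge0 // ltW.
have := ler_wpM2l (sqr_ge0 a) uW_le.
lra.
Qed.

Lemma sum_sample_prod (R : realType) d n (f : cube d -> R) :
  \sum_(X : sample d n) \prod_(i < n) f (X i) = (\sum_x f x) ^+ n.
Proof. by rewrite -(bigA_distr_bigA (fun=> f)) prodr_const card_ord. Qed.

(** With [N = 2B] hypotheses, each likelihood has second moment at most [3N/4] relative to that of
    [g], and [N - (3N/4 + N)/2 = N/8]. Both sides are sums over the hypotheses, not averages. *)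
Lemma block_risk (R : realType) d n B (g : cube d -> R) (a : R)
    (phi : 'I_B -> cube d) (t : sample d n -> 'I_B -> R)
    (f : 'I_B * bool -> cube d -> R) :
  (forall v x, f v x = g x + a * (-1) ^+ v.2 * walsh R d (phi v.1) x) ->
  (0 < B)%N -> (forall b, phi b != zcube d) ->
  (forall x, (2 * Mr R d)^-1 <= g x) -> \sum_x g x = 1 ->
  (forall v x, 0 < f v x) ->
  expR (n%:R * (2 * Mr R d * a ^+ 2)) <= 3 / 2 * B%:R ->
  a ^+ 2 * (2 * B%:R) / 8 <=
  \sum_v \sum_(X : sample d n) (\prod_(i < n) f v (X i)) *
    \sum_b (t X b - a * (-1) ^+ v.2 * (b == v.1)%:R) ^+ 2.
Proof.
move=> fE B_gt0 phi_neq0 g_ge g_sum f_gt0 info.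
have M_gt0 := Mr_gt0 R d.
have g_gt0 x : 0 < g x.
  by apply: lt_le_trans (g_ge x); rewrite invr_gt0 mulr_gt0.
pose N : R := 2 * B%:R; have N_gt0 : 0 < N by rewrite mulr_gt0 ?ltr0n.
have cardV : #|{: 'I_B * bool}|%:R = N.
  by rewrite card_prod card_bool card_ord natrM mulrC.
pose P v (X : sample d n) := \prod_(i < n) f v (X i).
pose P0 (X : sample d n) := \prod_(i < n) g (X i).
have P0_gt0 X : 0 < P0 X by apply: prodr_gt0.
have P_gt0 v X : 0 < P v X by apply: prodr_gt0.
have f_sum v : \sum_x f v x = 1.
  under eq_bigr do rewrite fE.
  by rewrite big_split /= g_sum -mulr_sumr sum_walsh ?mulr0 ?addr0.
(* The moment is the n-th power of its one-sample version [1 + chi2]. Since [g] is at least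
   [1/(2M)], [chi2] is at most [2 M a^2], and [1 + y <= exp y] finishes. *)
have chi v : \sum_X P v X ^+ 2 / P0 X <= 3 / 4 * N.
  have -> : \sum_X P v X ^+ 2 / P0 X =
            (\sum_x f v x ^+ 2 / g x) ^+ n.
    rewrite -sum_sample_prod; apply: eq_bigr => X _.
    by rewrite /P /P0 -prodrXl -prodf_div.
  apply: (@le_trans _ _ (3 / 2 * B%:R)); last by rewrite /N; lra.
  apply: le_trans info; rewrite expRM_natl.
  have fg_ge0 : 0 <= \sum_x f v x ^+ 2 / g x.
    by apply: sumr_ge0 => x _; rewrite divr_ge0 ?sqr_ge0 // ltW.
  apply: lerXn2r; rewrite ?nnegrE ?expR_ge0 //.
  apply: le_trans (expR_ge1Dx _).
  have -> : \sum_x f v x ^+ 2 / g x =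
      1 + a ^+ 2 * \sum_x walsh R d (phi v.1) x ^+ 2 / g x.
    have fgE x : f v x ^+ 2 / g x = f v x + a * (-1) ^+ v.2 * walsh R d (phi v.1) x
        + a ^+ 2 * (walsh R d (phi v.1) x ^+ 2 / g x).
      have g_neq0 : g x != 0 by rewrite gt_eqF.
      by rewrite fE; case: v.2 => /=; rewrite ?expr0 ?expr1; field.
    under eq_bigr do rewrite fgE.
    by rewrite !big_split /= f_sum -mulr_sumr sum_walsh // mulr0 addr0 -mulr_sumr.
  rewrite lerD2l mulrC ler_wpM2r ?sqr_ge0 //.
  have -> : 2 * Mr R d = \sum_x 2 * Mr R d * walsh R d (phi v.1) x ^+ 2.
    by rewrite -mulr_sumr walsh_sqr_sum mulr1.
  apply: ler_sum => x _; rewrite mulrC ler_wpM2r ?sqr_ge0 //.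
  by rewrite -[X in _ <= X]invrK lef_pV2 ?posrE ?invr_gt0 ?mulr_gt0.
rewrite exchange_big /=.
(* The free parameter is [Q = N * P0 X]: over all samples it sums to [N], and the quotient by it
   sums to the average of the moments bounded in [chi]. *)
apply: (@le_trans _ _ (\sum_X a ^+ 2 *
   (\sum_v P v X - ((\sum_v P v X ^+ 2) / (N * P0 X) + N * P0 X) / 2))); last first.
  apply: ler_sum => X _; apply: signed_spike_loss.
  - by move=> v; rewrite ltW.
  - rewrite (bigD1 (Ordinal B_gt0, true)) //= ltr_pwDl // sumr_ge0 // => v _.
    by rewrite ltW.
  - by rewrite mulr_gt0.
rewrite -mulr_sumr -mulrA ler_wpM2l ?sqr_ge0 //.
rewrite sumrB exchange_big /=.
have -> : \sum_v \sum_X P v X = N.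
  under eq_bigr do rewrite sum_sample_prod f_sum expr1n.
  by rewrite sumr_const -cardV.
rewrite -mulr_suml big_split /= -mulr_sumr sum_sample_prod g_sum expr1n mulr1.
have : \sum_X (\sum_v P v X ^+ 2) / (N * P0 X) <= 3 / 4 * N.
  under eq_bigr do rewrite mulr_suml.
  rewrite exchange_big /=.
  apply: (@le_trans _ _ (\sum_(v : 'I_B * bool) 3 / 4)).
    apply: ler_sum => v _.
    under eq_bigr do rewrite invfM mulrCA.
    by rewrite -mulr_sumr mulrC ler_pdivrMr.
  by rewrite sumr_const -[_ *+ _]mulr_natr cardV.
rewrite -/N; lra.
Qed.

(** * Redrawing one block; spiked densities and their membership in the class *)

Definition resample (T : finType) k (h : {ffun 'I_k -> T}) (j : 'I_k) (v : T) :
    {ffun 'I_k -> T} := [ffun i => if i == j then v else h i].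

(** Exchanging entry [j] of [h] with [v] is an involution on pairs. This allows one block to be
    redrawn while the others stay fixed. *)
Lemma sum_resample (R : realType) (T : finType) k (j : 'I_k)
    (F : {ffun 'I_k -> T} -> R) :
  \sum_h \sum_v F (resample T k h j v) = #|T|%:R * \sum_h F h.
Proof.
pose swap (q : {ffun 'I_k -> T} * T) := (resample T k q.1 j q.2, q.1 j).
have swapK : involutive swap.
  move=> [h v]; rewrite /swap /=; congr pair; last by rewrite ffunE eqxx.
  by apply/ffunP => i; rewrite !ffunE; case: eqP => // ->.
rewrite pair_bigA (reindex_inj (inv_inj swapK)).
rewrite (eq_bigr (fun q => F q.1)); last by move=> q _; rewrite -[in RHS](swapK q).
rewrite -(pair_bigA _ (fun h v => F h)) /= mulr_sumr; apply: eq_bigr => h _.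
by rewrite sumr_const mulr_natl.
Qed.

(** The constant [1/M] is the trivial character with coefficient [M^(-1/2)]; the pair [h j] selects
    the character of block [j] and its sign, [true] meaning minus. *)
Definition spikes (R : realType) d k B (iota : 'I_k -> 'I_B -> cube d) (a : R)
    (h : {ffun 'I_k -> 'I_B * bool}) (x : cube d) : R :=
  (Mr R d)^-1 +
  \sum_j a * (-1) ^+ (h j).2 * walsh R d (iota j (h j).1) x.

(** Each spike is at most [a / sqrt M] in absolute value, so [k] of them stay within [1/(2M)]. The
    predicate [P] covers both the full density and the one with a block removed. *)
Lemma sum_spikes_bound (R : realType) d k B (iota : 'I_k -> 'I_B -> cube d)
    (a : R) (P : pred 'I_k) (h : {ffun 'I_k -> 'I_B * bool}) x :
  0 <= a -> k%:R * a <= (2 * Num.sqrt (Mr R d))^-1 ->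
  - (2 * Mr R d)^-1 <=
    \sum_(j | P j) a * (-1) ^+ (h j).2 * walsh R d (iota j (h j).1) x.
Proof.
move=> a_ge0 ka_le; rewrite lerNl.
apply: le_trans (ler_norm _) _; rewrite normrN.
apply: le_trans (ler_norm_sum _ _ _) _.
have rM_gt0 := sqrtMr_gt0 R d.
apply: (@le_trans _ _ (\sum_(j < k) a * (Num.sqrt (Mr R d))^-1)).
  rewrite big_mkcond /=; apply: ler_sum => j _; case: ifP => _; last first.
    by rewrite mulr_ge0 // invr_ge0 ltW.
  by rewrite 2!normrM norm_walsh normrX normrN1 expr1n mulr1 (ger0_norm a_ge0).
rewrite sumr_const card_ord -[_ *+ _]mulr_natl mulrA.
rewrite -{2}sqr_sqrtMr expr2 mulrA invfM ler_wpM2r // invr_ge0.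
exact: ltW.
Qed.

Lemma theta_spikes (R : realType) d k B (iota : 'I_k -> 'I_B -> cube d) (a : R)
    (h : {ffun 'I_k -> 'I_B * bool}) s :
  theta R d (spikes R d k B iota a h) s =
  (Num.sqrt (Mr R d))^-1 * (zcube d == s)%:R +
  \sum_j a * (-1) ^+ (h j).2 * (iota j (h j).1 == s)%:R.
Proof.
rewrite /theta /spikes; under eq_bigr do rewrite mulrDl.
rewrite big_split /=; congr (_ + _).
  rewrite -walsh_orthonormal mulr_sumr; apply: eq_bigr => x _.
  by rewrite walsh0 [RHS]mulrA -invfM -expr2 sqr_sqrtMr.
under eq_bigr do rewrite mulr_suml.
rewrite exchange_big; apply: eq_bigr => j _ /=.
rewrite -walsh_orthonormal mulr_sumr; apply: eq_bigr => x _.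
by rewrite mulrA.
Qed.

(** The coefficients are [M^(-1/2)] at the trivial character, [k] of magnitude [a], and zeros. The
    envelope is met with equality at [m = 1], is at least [a] up to [m = k+1], and faces only zeros
    afterwards. *)
Lemma spikes_in_class (R : realType) d k B (iota : 'I_k -> 'I_B -> cube d)
    (a p : R) (h : {ffun 'I_k -> 'I_B * bool}) :
  injective (fun q => iota q.1 q.2) -> (forall j b, iota j b != zcube d) ->
  0 < p -> 0 <= a -> k%:R * a <= (2 * Num.sqrt (Mr R d))^-1 ->
  a <= (Num.sqrt (Mr R d))^-1 * powR (k.+1)%:R (- p^-1) ->
  Fclass_plus1 R d p (spikes R d k B iota a h).
Proof.
move=> iota_inj iota_neq0 p_gt0 a_ge0 ka_le a_le.
have rM_gt0 := sqrtMr_gt0 R d; have M_gt0 := Mr_gt0 R d.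
have V_ge0 : 0 <= p^-1 by rewrite invr_ge0 ltW.
have theta_le s : s != zcube d -> `|theta R d (spikes R d k B iota a h) s| <= a.
  move=> /negPf s_neq0; rewrite theta_spikes eq_sym s_neq0 mulr0 add0r.
  have [/existsP[j /eqP j_s]|/existsPn no_j] :=
    boolP [exists j, iota j (h j).1 == s].
    rewrite (bigD1 j) //= j_s eqxx mulr1 big1 ?addr0.
      by rewrite normrM normrX normrN1 expr1n mulr1 ger0_norm.
    move=> i neq_ij; case: eqP; rewrite ?mulr0 // -j_s => eq_iota.
    have /(congr1 fst)/= eq_ij : (i, (h i).1) = (j, (h j).1) by exact: iota_inj.
    by rewrite eq_ij eqxx in neq_ij.
  by rewrite big1 ?normr0 // => j _; rewrite (negPf (no_j j)) mulr0.
have theta0 : theta R d (spikes R d k B iota a h) (zcube d) = (Num.sqrt (Mr R d))^-1.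
  rewrite theta_spikes eqxx mulr1 big1 ?addr0 // => j _.
  by rewrite (negPf (iota_neq0 _ _)) mulr0.
have bound_ge0 i : 0 <= (Num.sqrt (Mr R d))^-1 * powR (i.+1)%:R (- p^-1).
  by rewrite mulr_ge0 ?powR_ge0 // invr_ge0 ltW.
split; [move=> i lt_i | split=> [x|]].
- apply: nth_sorted_coefs_le => //.
  have [le_ik|lt_ki] := leqP i k.
    have le_a : a <= (Num.sqrt (Mr R d))^-1 * powR (i.+1)%:R (- p^-1).
      apply: le_trans a_le _; rewrite ler_wpM2l ?invr_ge0 ?(ltW rM_gt0) //.
      rewrite !powRN lef_pV2 ?posrE ?powR_gt0 ?ltr0n //.
      by apply: ge0_ler_powR; rewrite ?nnegrE ?ler_nat.
    have sub1 : [set s | (Num.sqrt (Mr R d))^-1 * powR (i.+1)%:R (- p^-1)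
        < `|theta R d (spikes R d k B iota a h) s|] \subset [set zcube d].
      apply/subsetP => s; rewrite !inE; apply: contraTT => s_neq0.
      by rewrite -leNgt (le_trans (theta_le s s_neq0)).
    (* From index 1 on, the trivial coefficient may exceed the bound, being the only one; at index 0
       it equals the bound, so nothing exceeds it. *)
    case: i lt_i le_ik le_a sub1 => [|i] _ _ _ sub1; last first.
      by apply: leq_trans (subset_leq_card sub1) _; rewrite cards1.
    rewrite leqn0 cards_eq0; apply/eqP/setP => s; rewrite in_set0.
    apply/negbTE/negP => s_in; have /(subsetP sub1) := s_in.
    rewrite inE => /eqP s0; move: s_in.
    by rewrite inE s0 theta0 powR1 mulr1 ger0_norm ?ltxx // invr_ge0 ltW.
  apply: leq_trans lt_ki.
  apply: (@leq_trans #|zcube d |: [set iota j (h j).1 | j : 'I_k]|).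
    apply: subset_leq_card; apply/subsetP => s; rewrite !inE.
    apply: contraTT; rewrite negb_or => /andP[/negPf s_neq0 s_notin].
    rewrite -leNgt theta_spikes eq_sym s_neq0 mulr0 add0r big1 ?normr0 // => j _.
    case: eqP => [j_s|_]; rewrite ?mulr0 //.
    by case/imsetP: s_notin; exists j.
  rewrite cardsU1 -add1n leq_add ?leq_b1 //.
  by apply: leq_trans (leq_imset_card _ _) _; rewrite card_ord.
- have := sum_spikes_bound R d k B iota a predT h x a_ge0 ka_le.
  rewrite /spikes invfM; have : 0 < (Mr R d)^-1 by rewrite invr_gt0.
  lra.
rewrite /spikes big_split /= sumr_const card_cube -[_ *+ _]mulr_natr mulVf.
  rewrite exchange_big big1 ?addr0 //= => j _.
  by rewrite -mulr_sumr sum_walsh ?mulr0.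
by rewrite gt_eqF.
Qed.

(** Blocks are consecutive runs of length [B] in an enumeration of the [2^d - 1] nonzero
    characters. *)
Lemma nonzero_blocks d k B : (k * B < 2 ^ d)%N ->
  exists iota : 'I_k -> 'I_B -> cube d,
    injective (fun q => iota q.1 q.2) /\ forall j b, iota j b != zcube d.
Proof.
move=> kB_lt; pose nz := enum [set~ zcube d].
have size_nz : (k * B <= size nz)%N.
  by rewrite -cardE cardsC1 card_cube -ltnS prednK // expn_gt0.
have idx_lt (j : 'I_k) (b : 'I_B) : (j * B + b < k * B)%N.
  have := ltn_ord j; have := ltn_ord b; nia.
exists (fun j b => nth (zcube d) nz (j * B + b)); split; last first.
  move=> j b; have : nth (zcube d) nz (j * B + b) \in nz.
    by rewrite mem_nth // (leq_trans (idx_lt j b)).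
  by rewrite mem_enum !inE.
move=> [i b] [j c] /= /eqP; rewrite nth_uniq ?enum_uniq //; last first.
- by rewrite (leq_trans (idx_lt _ _)).
- by rewrite (leq_trans (idx_lt _ _)).
have lt_b := ltn_ord b; have lt_c := ltn_ord c => /eqP eq_idx.
have eq_ij : i = j.
  apply: val_inj => /=.
  have : ((i * B + b) %/ B = (j * B + c) %/ B)%N by rewrite eq_idx.
  by rewrite !divnMDl ?divn_small ?addn0 // (leq_ltn_trans _ lt_b).
move: eq_idx; rewrite eq_ij => /addnI eq_bc.
by congr pair; apply: val_inj.
Qed.

(** * From block risks to the minimax risk *)

(** Parseval splits the loss over characters; those of the blocks are distinct by injectivity, and
    the remaining ones are dropped. *)
Lemma risk_ge_blocks (R : realType) d n k B (iota : 'I_k -> 'I_B -> cube d)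
    (fhat : estimator R d n) (f : cube d -> R) :
  injective (fun q => iota q.1 q.2) -> (forall x, 0 <= f x) ->
  \sum_j \sum_(X : sample d n) (\prod_(i < n) f (X i)) *
    \sum_b (theta R d (fhat X) (iota j b) - theta R d f (iota j b)) ^+ 2
  <= risk R d n fhat f.
Proof.
move=> iota_inj f_ge0; rewrite exchange_big /= /risk; apply: ler_sum => X _.
rewrite -mulr_sumr ler_wpM2l ?prodr_ge0 // parseval.
under [leRHS]eq_bigr do rewrite thetaB.
pose F s := (theta R d (fhat X) s - theta R d f s) ^+ 2.
rewrite (pair_bigA _ (fun j b => F (iota j b))) /=.
rewrite [leRHS](bigID (mem [set iota q.1 q.2 | q : 'I_k * 'I_B])) /=.
rewrite big_imset /=; last by move=> q q' _ _; exact: iota_inj.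
by rewrite lerDl sumr_ge0 // => s _; exact: sqr_ge0.
Qed.

Lemma block_average_risk (R : realType) d n k B (iota : 'I_k -> 'I_B -> cube d)
    (fhat : estimator R d n) (a : R) (j : 'I_k) :
  injective (fun q => iota q.1 q.2) -> (forall j b, iota j b != zcube d) ->
  (0 < B)%N -> 0 <= a -> k%:R * a <= (2 * Num.sqrt (Mr R d))^-1 ->
  expR (n%:R * (2 * Mr R d * a ^+ 2)) <= 3 / 2 * B%:R ->
  a ^+ 2 / 8 * #|{ffun 'I_k -> 'I_B * bool}|%:R <=
  \sum_(h : {ffun 'I_k -> 'I_B * bool})
    \sum_(X : sample d n) (\prod_(i < n) spikes R d k B iota a h (X i)) *
    \sum_b (theta R d (fhat X) (iota j b) -
            theta R d (spikes R d k B iota a h) (iota j b)) ^+ 2.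
Proof.
move=> iota_inj iota_neq0 B_gt0 a_ge0 ka_le info.
have M_gt0 := Mr_gt0 R d; have MV_gt0 : 0 < (Mr R d)^-1 by rewrite invr_gt0.
have N_gt0 : 0 < 2 * B%:R :> R by rewrite mulr_gt0 ?ltr0n.
have cardV : #|{: 'I_B * bool}|%:R = 2 * B%:R :> R.
  by rewrite card_prod card_bool card_ord natrM mulrC.
(* Scaling by the number [2B] of choices introduces a redraw of block [j], so that [block_risk]
   applies for each fixed choice of the other blocks. *)
rewrite -(ler_pM2l N_gt0) -{2}cardV -(sum_resample _ _ _ j).
have -> : 2 * B%:R * (a ^+ 2 / 8 * #|{ffun 'I_k -> 'I_B * bool}|%:R) =
    \sum_(h : {ffun 'I_k -> 'I_B * bool}) a ^+ 2 * (2 * B%:R) / 8.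
  by rewrite sumr_const -[_ *+ _]mulr_natr; ring.
apply: ler_sum => h _.
pose g x := (Mr R d)^-1 +
  \sum_(i | i != j) a * (-1) ^+ (h i).2 * walsh R d (iota i (h i).1) x.
pose f v := spikes R d k B iota a (resample _ k h j v).
have fE v x : f v x = g x + a * (-1) ^+ v.2 * walsh R d (iota j v.1) x.
  rewrite /f /spikes (bigD1 j) //= ffunE eqxx /g -addrA; congr (_ + _).
  rewrite addrC; congr (_ + _); apply: eq_bigr => i /negPf neq_ij.
  by rewrite ffunE neq_ij.
have := block_risk R d n B g a (iota j)
  (fun X b => theta R d (fhat X) (iota j b)) f fE B_gt0 (iota_neq0 j).
move=> /(_ _ _ _ info) block.
apply: le_trans (block _ _ _) _.
- move=> x; have := sum_spikes_bound R d k B iota a (fun i => i != j) h x a_ge0 ka_le.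
  by rewrite /g invfM; lra.
- rewrite /g big_split /= sumr_const card_cube -[_ *+ _]mulr_natr mulVf.
    rewrite exchange_big big1 ?addr0 //= => i _.
    by rewrite -mulr_sumr sum_walsh ?mulr0.
  by rewrite gt_eqF.
- move=> v x; have := sum_spikes_bound R d k B iota a predT (resample _ k h j v) x a_ge0 ka_le.
  by rewrite /f /spikes invfM; lra.
apply: ler_sum => v _; apply: ler_sum => X _.
rewrite le_eqVlt; apply/orP; left; apply/eqP; congr (_ * _).
apply: eq_bigr => b _; congr ((_ - _) ^+ 2).
(* By injectivity, only the spike of block [j] contributes to the coefficients in that block. *)
rewrite theta_spikes [zcube d == _]eq_sym (negPf (iota_neq0 j b)) mulr0 add0r.
rewrite (bigD1 j) //= ffunE eqxx big1 ?addr0.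
  congr (_ * (nat_of_bool _)%:R); rewrite eq_sym; apply/eqP/eqP => [-> //|eq_iota].
  by have /(congr1 snd) : (j, v.1) = (j, b) by exact: iota_inj.
move=> i /negPf neq_ij; case: eqP; rewrite ?mulr0 // => eq_iota.
have /(congr1 fst)/= eq_ij : (i, (resample _ k h j v i).1) = (j, b).
  exact: iota_inj.
by rewrite eq_ij eqxx in neq_ij.
Qed.

(** If every spiked density had risk at most [b'], so would their average, against the block bounds.
    The factor 2 in the bound on [a] secures positivity. *)
Lemma minimax_ge_blocks (R : realType) d n k B (a p : R) :
  (0 < B)%N -> (k * B < 2 ^ d)%N -> 0 < p -> p <= 1 -> 0 <= a ->
  a <= (2 * Num.sqrt (Mr R d))^-1 * powR (k.+1)%:R (- p^-1) ->
  expR (n%:R * (2 * Mr R d * a ^+ 2)) <= 3 / 2 * B%:R ->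
  minimax_ge R d n p (k%:R * a ^+ 2 / 8).
Proof.
move=> B_gt0 kB_lt p_gt0 p_le1 a_ge0 a_le info fhat b' b'_lt.
have rM_gt0 := sqrtMr_gt0 R d.
have rV_ge0 : 0 <= (Num.sqrt (Mr R d))^-1 by rewrite invr_ge0 ltW.
have [iota [iota_inj iota_neq0]] := nonzero_blocks d k B kB_lt.
(* Here [p <= 1] enters, through [(k+1)^(-1/p) <= 1/(k+1)]. *)
have ka_le : k%:R * a <= (2 * Num.sqrt (Mr R d))^-1.
  have pow_le : powR (k.+1)%:R (- p^-1) <= (k.+1%:R)^-1 :> R.
    by rewrite -(powR_inv1 (ler0n R k.+1)) ler_powR ?ler1n // lerN2 invf_ge1.
  apply: (@le_trans _ _ ((k.+1)%:R * a)); first by rewrite ler_wpM2r ?ler_nat.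
  rewrite mulrC -ler_pdivlMr ?ltr0n //.
  apply: le_trans a_le _; rewrite ler_wpM2l // invr_ge0 mulr_ge0 // ltW //.
have a_le' : a <= (Num.sqrt (Mr R d))^-1 * powR (k.+1)%:R (- p^-1).
  apply: le_trans a_le _; rewrite ler_wpM2r ?powR_ge0 // invfM.
  lra.
have in_class h := spikes_in_class R d k B iota a p h iota_inj iota_neq0
  p_gt0 a_ge0 ka_le a_le'.
have [/existsP[h lt_h]|/existsPn no_h] :=
    boolP [exists h, b' < risk R d n fhat (spikes R d k B iota a h)].
  by exists (spikes R d k B iota a h).
pose K : R := #|{ffun 'I_k -> 'I_B * bool}|%:R.
have K_gt0 : 0 < K.
  by rewrite ltr0n card_ffun expn_gt0 card_prod card_bool card_ord muln_gt0 B_gt0.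
have le_b' : \sum_h risk R d n fhat (spikes R d k B iota a h) <= b' * K.
  rewrite /K mulr_natr -sumr_const; apply: ler_sum => h _.
  by rewrite leNgt no_h.
have : k%:R * a ^+ 2 / 8 * K <= b' * K.
  apply: le_trans le_b'.
  apply: (@le_trans _ _ (\sum_(j < k) a ^+ 2 / 8 * K)).
    by rewrite sumr_const card_ord -[leRHS]mulr_natl !mulrA.
  apply: le_trans (ler_sum _ (fun j _ => block_average_risk R d n k B iota fhat
    a j iota_inj iota_neq0 B_gt0 a_ge0 ka_le info)) _.
  rewrite exchange_big /=; apply: ler_sum => h _.
  by apply: risk_ge_blocks => //; case: (in_class h) => _ [].
by rewrite ler_pM2r // leNgt b'_lt.
Qed.

(** * Choice of block number, block size and amplitude in the two regimes *)

Lemma minimax_geW (R : realType) d n (p b c : R) :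
  b <= c -> minimax_ge R d n p c -> minimax_ge R d n p b.
Proof. by move=> le_bc ge_c fhat b' /lt_le_trans/(_ le_bc)/ge_c. Qed.

Lemma ln2_ge_half (R : realType) : 2^-1 <= ln (2 : R).
Proof.
have := @le_ln1Dx R (- 2^-1); have -> : 1 + - 2^-1 = 2^-1 :> R by field.
rewrite lnV ?posrE // lerN2; apply; lra.
Qed.

Lemma Mr_ge2 (R : realType) d : (1 <= d)%N -> 2 <= Mr R d.
Proof.
by move=> d_ge1; rewrite /Mr ler_nat -{1}[2%N]expn1 leq_exp2l.
Qed.

(** Both regimes use the fraction [sqrt c] of the largest amplitude allowed by [minimax_ge_blocks];
    [c] tunes the information [2 n M a^2]. *)
Lemma sqr_amplitude (R : realType) (c M x p : R) : 0 <= c -> 0 < M ->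
  (Num.sqrt c * ((2 * Num.sqrt M)^-1 * powR x (- p^-1))) ^+ 2 =
  c / (4 * M) * powR x (- (2 / p)).
Proof.
move=> c_ge0 M_gt0; rewrite !exprMn exprVn exprMn !sqr_sqrtr ?(ltW M_gt0) //.
rewrite -(powR_mulrn 2 (powR_ge0 x _)) -powRrM mulrA.
have -> : - p^-1 * 2 = - (2 / p) by rewrite mulNr mulrC.
by congr (_ / (_ * _) * _); ring.
Qed.

Lemma minimax_large_sample (R : realType) (p : R) d n : 0 < p -> p <= 1 ->
  powR (Mr R d) (2 / p) <= n%:R -> 4 <= Mr R d ->
  minimax_ge R d n p (128^-1 / n%:R).
Proof.
move=> p_gt0 p_le1 n_ge M_ge4; have M_gt0 := Mr_gt0 R d.
have n_gt0 : 0 < n%:R :> R by apply: lt_le_trans n_ge; exact: powR_gt0.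
have rM_gt0 := sqrtMr_gt0 R d.
pose k := (2 ^ d).-1; have kS : k.+1 = (2 ^ d)%N by rewrite prednK ?expn_gt0.
(* Chosen to give [a^2 = 1/(8 M n)], hence information [1/4] whatever [p] is; the lower bound on [n]
   makes it admissible. *)
pose c : R := 2^-1 * (powR (Mr R d) (2 / p) / n%:R).
have c_ge0 : 0 <= c by rewrite /c mulr_ge0 ?divr_ge0 ?powR_ge0 ?invr_ge0 ?(ltW n_gt0).
have c_le1 : c <= 1.
  have : powR (Mr R d) (2 / p) / n%:R <= 1 by rewrite ler_pdivrMr // mul1r.
  rewrite /c; lra.
pose a := Num.sqrt c * ((2 * Num.sqrt (Mr R d))^-1 * powR (k.+1)%:R (- p^-1)).
have aE : a ^+ 2 = (8 * Mr R d * n%:R)^-1.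
  rewrite /a sqr_amplitude // kS -/(Mr R d) powRN /c.
  field; rewrite !gt_eqF ?powR_gt0 //.
have kR : k%:R = Mr R d - 1 :> R by rewrite /Mr -kS -addn1 natrD addrK.
apply: (minimax_geW _ _ _ _ _ (k%:R * a ^+ 2 / 8)).
  rewrite aE kR -subr_ge0.
  have -> : (Mr R d - 1) * (8 * Mr R d * n%:R)^-1 / 8 - 128^-1 / n%:R =
     (Mr R d - 2) / (128 * Mr R d * n%:R) by field; rewrite !gt_eqF.
  by rewrite divr_ge0 ?mulr_ge0 ?(ltW M_gt0) ?(ltW n_gt0) //; lra.
apply: (minimax_ge_blocks _ _ _ _ 1) => //.
- by rewrite muln1 -kS.
- by rewrite !mulr_ge0 ?sqrtr_ge0 ?invr_ge0 ?powR_ge0 ?mulr_ge0 ?ltW.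
- rewrite /a ler_piMl ?mulr_ge0 ?invr_ge0 ?powR_ge0 ?mulr_ge0 ?(ltW rM_gt0) //.
  by rewrite -[leRHS]sqrtr1 ler_wsqrtr.
rewrite aE mulr1.
have -> : n%:R * (2 * Mr R d * (8 * Mr R d * n%:R)^-1) = 4^-1 :> R.
  by field; rewrite !gt_eqF.
(* From [exp(-1/4) >= 3/4] follows [exp(1/4) <= 4/3 < 3/2], the requirement for [B = 1]. *)
have := expR_ge1Dx (- 4^-1 : R); rewrite expRN => e_ge.
have e_gt0 := expR_gt0 (4^-1 : R).
have : 3 / 4 * expR 4^-1 <= 1 :> R.
  rewrite -ler_pdivlMr // mul1r; apply: le_trans e_ge; lra.
lra.
Qed.

Lemma minimax_small_sample (R : realType) (p eps : R) d n :
  0 < p -> p <= 1 -> 0 < eps -> eps < 1 -> (1 <= d)%N ->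
  ln (Mr R d) <= n%:R -> n%:R <= powR (Mr R d) (2 * (1 - eps) / p) ->
  minimax_ge R d n p
    (eps / 192 * powR 2 (- (2 / p)) / Mr R d *
     powR (n%:R / ln (Mr R d)) (p / 2 - 1)).
Proof.
move=> p_gt0 p_le1 e_gt0 e_lt1 d_ge1 n_ge n_le.
have M_ge2 := Mr_ge2 R d d_ge1; have M_gt0 := Mr_gt0 R d.
have M_ge1 : 1 <= Mr R d by lra.
have rM_gt0 := sqrtMr_gt0 R d.
set M := Mr R d in n_ge n_le M_ge2 M_ge1 M_gt0 rM_gt0 *.
set L := ln M in n_ge *.
have L_ge : 2^-1 <= L.
  by apply: le_trans (ln2_ge_half R) _; rewrite /L ler_ln ?posrE.
have L_gt0 : 0 < L by lra.
have n_gt0 : 0 < n%:R :> R by lra.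
have nL_gt0 : 0 < n%:R / L by rewrite divr_gt0.
have nL_le : n%:R / L <= 2 * n%:R.
  by rewrite ler_pdivrMr //; nra.
have p2_ge0 : 0 <= p / 2 by lra.
have q_ge2 : 2 <= 2 / p by rewrite ler_pdivlMr //; lra.
(* The sparsity with [z^(2/p) = n/L], at which the information per block is of order [L]. *)
pose z := powR (n%:R / L) (p / 2).
have z_ge1 : 1 <= z.
  apply: (@le_trans _ _ (powR 1 (p / 2))); first by rewrite powR1.
  apply: ge0_ler_powR; rewrite ?nnegrE ?(ltW nL_gt0) //.
  by rewrite ler_pdivlMr // mul1r.
have zq : powR z (2 / p) = n%:R / L.
  rewrite /z -powRrM (_ : p / 2 * (2 / p) = 1); last by field; rewrite gt_eqF.
  by rewrite powRr1 // ltW.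
(* The cap [M - 1] guarantees at least one character per block. *)
pose k := minn (Num.truncn z) (2 ^ d).-1.
have M_natE : M = ((2 ^ d).-1.+1)%:R by rewrite prednK ?expn_gt0.
have k_gt0 : (0 < k)%N.
  rewrite leq_min truncn_gt0 z_ge1 /= -subn1 subn_gt0.
  by rewrite -{1}[1%N](expn0 2) ltn_exp2l.
have kR_gt0 : 0 < k%:R :> R by rewrite ltr0n.
have k_le_z : k%:R <= z.
  apply: (@le_trans _ _ (Num.truncn z)%:R); first by rewrite ler_nat geq_minl.
  by rewrite truncn_le //; lra.
(* If the cap is active, [k+1 = M] and the upper bound on [n] suffices; the factor [1/2] compensates
   for [L] being possibly as small as [1/2]. *)
have kS_ge : n%:R / L / 2 <= powR (k.+1)%:R (2 / p).
  have [kE|kE] : k = Num.truncn z \/ k = (2 ^ d).-1.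
  - by rewrite /k; case: leqP; [left|right].
  - have : powR z (2 / p) <= powR (k.+1)%:R (2 / p).
      apply: ge0_ler_powR; rewrite ?nnegrE ?kE ?ler0n //; try lra.
      by rewrite ltW // truncnS_gt.
    rewrite zq; lra.
  rewrite kE -M_natE; apply: (@le_trans _ _ n%:R); first lra.
  apply: le_trans n_le _; rewrite ler_powR // ler_pM2r ?invr_gt0 //; lra.
pose B := ((2 ^ d).-1 %/ k)%N.
have B_gt0 : (0 < B)%N by rewrite divn_gt0 // geq_minr.
have kB_lt : (k * B < 2 ^ d)%N.
  rewrite mulnC (leq_ltn_trans (leq_trunc_div _ _)) //.
  by rewrite ltn_predL expn_gt0.
have M_le : M <= 2 * B%:R * k%:R.
  rewrite /M /Mr -!natrM ler_nat.
  apply: (@leq_trans (B.+1 * k)); first by rewrite -[leqLHS]prednK ?expn_gt0 ?ltn_ceil.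
  by rewrite leq_mul2r mul2n -addnn -addn1 leq_add2l B_gt0 orbT.
(* The margin [eps] in the range of [n] is spent here: it leaves each block at least [M^eps / 4]
   characters. *)
have k_le : k%:R <= 2 * powR M (1 - eps).
  apply: le_trans k_le_z _.
  apply: (@le_trans _ _ (powR (2 * powR M (2 * (1 - eps) / p)) (p / 2))).
    apply: (ge0_ler_powR p2_ge0); rewrite ?nnegrE ?(ltW nL_gt0) ?mulr_ge0 ?powR_ge0 //.
    by apply: le_trans nL_le _; rewrite ler_pM2l.
  rewrite powRM ?powR_ge0 // -powRrM.
  rewrite (_ : 2 * (1 - eps) / p * (p / 2) = 1 - eps); last by field; rewrite gt_eqF.
  rewrite ler_wpM2r ?powR_ge0 // -[leRHS]powRr1 // ler_powR //; lra.
have Meps_le : powR M eps <= 4 * B%:R.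
  have M1e_gt0 : 0 < powR M (1 - eps) by exact: powR_gt0.
  rewrite -(ler_pM2r M1e_gt0) -powRD; last by apply/implyP => _; rewrite gt_eqF.
  rewrite (_ : eps + (1 - eps) = 1); last by ring.
  rewrite powRr1; last exact: ltW.
  apply: le_trans M_le _; rewrite (_ : 4 * B%:R = 2 * B%:R * 2); last by ring.
  by rewrite -[leRHS]mulrA ler_wpM2l ?mulr_ge0.
have B_ge1 : 1 <= B%:R :> R by rewrite ler1n.
(* Sixth powers absorb the factor 4 even when [B = 1]: [M^eps <= 4B <= (3B/2)^6]. Hence the constant
   [eps/6]. *)
have exp_le : expR (eps / 6 * L) <= 3 / 2 * B%:R.
  rewrite -(@ler_pXn2r _ 6) ?nnegrE ?expR_ge0 //; last by lra.
  rewrite -expRM_natl (_ : 6%:R * (eps / 6 * L) = eps * L); last by field.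
  rewrite mulrC -ln_powR lnK ?posrE ?powR_gt0 // in Meps_le *.
  apply: le_trans Meps_le _; rewrite exprMn.
  have B6 : B%:R <= B%:R ^+ 6 :> R by rewrite ler_eXnr.
  have : 4 <= (3 / 2) ^+ 6 :> R by lra.
  nra.
(* With this amplitude [kS_ge] bounds the information by [(eps/6) L]. *)
pose a := Num.sqrt (eps / 6) * ((2 * Num.sqrt M)^-1 * powR (k.+1)%:R (- p^-1)).
have aE : a ^+ 2 = eps / 6 / (4 * M) * powR (k.+1)%:R (- (2 / p)).
  by rewrite /a sqr_amplitude // divr_ge0 // ltW.
have kSq_gt0 : 0 < powR (k.+1)%:R (2 / p) :> R by rewrite powR_gt0 // ltr0n.
apply: (minimax_geW _ _ _ _ _ (k%:R * a ^+ 2 / 8)); last first.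
  apply: (minimax_ge_blocks _ _ _ _ B) => //.
  - by rewrite !mulr_ge0 ?sqrtr_ge0 ?invr_ge0 ?powR_ge0 ?mulr_ge0 ?ltW.
  - rewrite /a ler_piMl ?mulr_ge0 ?invr_ge0 ?powR_ge0 ?mulr_ge0 ?(ltW rM_gt0) //.
    by rewrite -[leRHS]sqrtr1 ler_wsqrtr //; lra.
  apply: le_trans exp_le; rewrite ler_expR aE powRN -/M.
  have -> : n%:R * (2 * M * (eps / 6 / (4 * M) / powR (k.+1)%:R (2 / p))) =
      eps / 6 * (n%:R / 2 / powR (k.+1)%:R (2 / p)).
    by field; rewrite !gt_eqF.
  rewrite ler_pM2l; last by lra.
  by rewrite ler_pdivrMr // -ler_pdivrMl // [leLHS]mulrC mulrAC.
rewrite aE.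
have -> : powR (n%:R / L) (p / 2 - 1) = powR z (1 - 2 / p).
  by rewrite /z -powRrM; congr powR; field; rewrite gt_eqF.
have zk : powR z (1 - 2 / p) <= powR k%:R (1 - 2 / p).
  have -> : 1 - 2 / p = - (2 / p - 1) by ring.
  rewrite !powRN lef_pV2 ?posrE ?powR_gt0 //.
  by apply: ge0_ler_powR; rewrite ?nnegrE //; lra.
(* Passing from [k+1] to [2k] costs the factor [2^(-2/p)]; the number 192 is [6 * 4 * 8]. *)
have kSk : powR 2 (- (2 / p)) * powR k%:R (1 - 2 / p) <=
           k%:R * powR (k.+1)%:R (- (2 / p)).
  rewrite powRD; last by apply/implyP => _; rewrite gt_eqF.
  rewrite powRr1 ?ler0n // mulrCA ler_pM2l // -powRM //.
  rewrite !powRN lef_pV2 ?posrE ?powR_gt0 ?mulr_gt0 //.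
  apply: ge0_ler_powR; rewrite ?nnegrE ?mulr_ge0 //; first by lra.
  by rewrite -natrM ler_nat mul2n -addnn -addn1 leq_add2l.
have C_ge0 : 0 <= eps / 192 / M by rewrite !divr_ge0 // ltW.
apply: (@le_trans _ _ (eps / 192 / M * (powR 2 (- (2 / p)) * powR k%:R (1 - 2 / p)))).
  rewrite (_ : eps / 192 * powR 2 (- (2 / p)) / M * powR z (1 - 2 / p) =
    eps / 192 / M * (powR 2 (- (2 / p)) * powR z (1 - 2 / p))); last first.
    by field; rewrite gt_eqF.
  by rewrite ler_wpM2l // ler_wpM2l ?powR_ge0.
rewrite (_ : k%:R * (eps / 6 / (4 * M) * powR (k.+1)%:R (- (2 / p))) / 8 =
  eps / 192 / M * (k%:R * powR (k.+1)%:R (- (2 / p)))); last first.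
  by field; rewrite gt_eqF.
by rewrite ler_wpM2l.
Qed.

Theorem theorem2 (R : realType) :
  (* (1) *)
  (forall p eps : R, 0 < p -> p <= 1 -> 0 < eps -> eps < 1 ->
     let r := p^-1 - 2^-1 in
     exists C : R, 0 < C /\
       forall d n : nat, (1 <= d)%N ->
         ln (Mr R d) <= n%:R -> n%:R <= powR (Mr R d) (2 * (1 - eps) / p) ->
         minimax_ge R d n p
           (C / Mr R d * powR (ln (Mr R d) / n%:R) (2 * r / (2 * r + 1)))) /\
  (* (2) *)
  (exists C : R, 0 < C /\
     forall (p : R) (d n : nat), 0 < p -> p <= 1 ->
       powR (Mr R d) (2 / p) <= n%:R -> 4 <= Mr R d ->
       minimax_ge R d n p (C / n%:R)).
Proof.
split=> [p eps p_gt0 p_le1 e_gt0 e_lt1 r|]; last first.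
  exists 128^-1; split; first by rewrite invr_gt0.
  by move=> p d n; exact: minimax_large_sample.
exists (eps / 192 * powR 2 (- (2 / p))); split.
  by rewrite mulr_gt0 ?divr_gt0 ?powR_gt0.
move=> d n d_ge1 n_ge n_le.
have ratio_ge0 : 0 <= n%:R / ln (Mr R d).
  by rewrite divr_ge0 // ln_ge0 // (le_trans _ (Mr_ge2 R d d_ge1)) // ler1n.
(* As [2r + 1 = 2/p], the exponent is [1 - p/2], and inverting the ratio changes its sign. *)
have -> : powR (ln (Mr R d) / n%:R) (2 * r / (2 * r + 1)) =
          powR (n%:R / ln (Mr R d)) (p / 2 - 1).
  rewrite -invf_div -(powR_inv1 ratio_ge0) -powRrM; congr powR.
  by rewrite /r; field; rewrite gt_eqF //=; lra.
exact: (minimax_small_sample _ _ _ _ _ p_gt0 p_le1 e_gt0 e_lt1).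
Qed.
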